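(* Assume at least one agent satisfies (M), every agent satisfying (M) is of type P or type E, at least one agent is of type E, and for all $\chi(0)\in\Delta_{A-1}^o$ and $i,j\in[A]$ the statements $\liminf_{N\to\infty}F_i(\chi_i(0)N)/F_j(\chi_j(0)N)=0$ and $\limsup_{N\to\infty}F_i(\chi_i(0)N)/F_j(\chi_j(0)N)=\infty$ do not hold simultaneously. If agent $i$ is of type E and $\chi(0)$ lies in the interior of $D_i$, then $\lim_{N\to\infty}\mathbb{P}(tMon_i(\chi(0),N))=1$.
   Context: Fix $A\ge 2$, $[A]=\{1,\dots,A\}$, and feedback functions $F_i:\mathbb{N}\to(0,\infty)$. The generalized Pólya urn is the Markov chain $X(n)\in\mathbb{N}^A$, $n\in\mathbb{N}_0$, with $X_i(0)\ge1$ and $\mathbb{P}(X(n+1)=X(n)+e^{(i)}\mid X(n))=F_i(X_i(n))/\sum_{j}F_j(X_j(n))$. $N=\sum_iX_i(0)$; $\Delta_{A-1}^o$ is the interior of the simplex $\{x\in[0,1]^A:\sum x_i=1\}$. For fixed $\chi(0)$ the process starts from $X_i(0)=\chi_i(0)N$ (rounded), and each $F_i$ is extended to a $C^1$ function on $(0,\infty)$ monotone on every $[n,n+1]$. $tMon_i(\chi(0),N)=\{\forall n\ge0\ \forall j\ne i:X_j(n)=X_j(0)\}$, $sMon_i(\chi(0),N)=\{\lim_n\sum_{j\ne i}X_j(n)<\infty\}$, and $D_i=\{\chi(0)\in\Delta_{A-1}^o:\lim_{N\to\infty}\mathbb{P}(sMon_i(\chi(0),N))=1\}$. Condition (M): $\sum_{k\ge1}1/F_i(k)<\infty$.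 Type P: (M) and $\lim_kF_i(k)\sum_{l\ge k}1/F_i(l)=\infty$. Type E: (M) and $\limsup_kF_i(k)\sum_{l\ge k}1/F_i(l)<\infty$. *)

(* Defs.v *)
From HB Require Import structures.
From mathcomp Require Import all_boot all_order all_algebra.
From mathcomp Require Import all_classical all_reals all_analysis.
Set Implicit Arguments. Unset Strict Implicit. Unset Printing Implicit Defensive.
Import Order.TTheory GRing.Theory Num.Theory.
Import numFieldNormedType.Exports.
Local Open Scope classical_set_scope.
Local Open Scope ring_scope.

Definition state (A : nat) := {ffun 'I_A -> nat}.

Definition incr (A : nat) (x : state A) (i : 'I_A) : state A :=
  [ffun j => x j + (j == i)]%N.

(* transition probability F_i(x_i) / sum_j F_j(x_j); the feedback function
   F i is the C^1 extension, and is evaluated at natural numbers here. *)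
Definition trans_prob (R : realType) (A : nat) (F : 'I_A -> R -> R)
  (x : state A) (i : 'I_A) : R :=
  F i (x i)%:R / \sum_(j < A) F j (x j)%:R.

(* The process X (on Omega) under P is the generalized Polya urn started at x0:
   finite-dimensional distributions are those of the Markov chain. *)
Definition is_urn (R : realType) (A : nat) (F : 'I_A -> R -> R)
  (d : measure_display) (Omega : measurableType d) (P : probability Omega R)
  (X : nat -> Omega -> state A) (x0 : state A) : Prop :=
  (forall n v, measurable [set w | X n w = v]) /\
  P [set w | X 0%N w = x0] = 1%E /\
  (forall (n : nat) (h : nat -> state A) (i : 'I_A),
     P [set w | (forall k, (k <= n)%N -> X k w = h k) /\
                X n.+1 w = incr (h n) i]
     = (P [set w | forall k, (k <= n)%N -> X k w = h k]
        * (trans_prob F (h n) i)%:E)%E).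

Definition tMon (A : nat) (d : measure_display) (Omega : measurableType d)
  (X : nat -> Omega -> state A) (i : 'I_A) : set Omega :=
  [set w | forall n (j : 'I_A), j != i -> X n w j = X 0%N w j].

(* sMon_i : lim_n sum_{j<>i} X_j(n) exists and is finite (a convergent
   sequence of naturals is eventually constant) *)
Definition sMon (A : nat) (d : measure_display) (Omega : measurableType d)
  (X : nat -> Omega -> state A) (i : 'I_A) : set Omega :=
  [set w | exists m, forall n, (m <= n)%N ->
     (\sum_(j < A | j != i) X n w j = \sum_(j < A | j != i) X m w j)%N].

Definition open_simplex (R : realType) (A : nat) : set ('I_A -> R) :=
  [set chi | (forall j, 0 < chi j) /\ \sum_(j < A) chi j = 1].

Definition start (R : realType) (A : nat) (chi : 'I_A -> R) (N : nat) : state A :=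
  [ffun j => `|Num.ceil (chi j * N%:R)|%N].

Definition Dset (R : realType) (A : nat) (d : measure_display)
  (Omega : measurableType d) (P : state A -> probability Omega R)
  (X : nat -> Omega -> state A) (i : 'I_A) : set ('I_A -> R) :=
  [set chi | @open_simplex R A chi /\
     (fun N => P (start chi N) (sMon X i)) @ \oo --> 1%E].

Definition simplex_interior (R : realType) (A : nat) (S : set ('I_A -> R))
  : set ('I_A -> R) :=
  [set chi | @open_simplex R A chi /\ exists2 e : R, 0 < e &
     forall chi', @open_simplex R A chi' ->
       (forall j, `|chi' j - chi j| < e) -> S chi'].

Definition tail (R : realType) (A : nat) (F : 'I_A -> R -> R) (i : 'I_A) (k : nat)
  : \bar R := (\sum_(k <= l <oo) ((F i l%:R)^-1)%:E)%E.

Definition condM (R : realType) (A : nat) (F : 'I_A -> R -> R) (i : 'I_A) : Prop :=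
  (tail F i 1 < +oo)%E.

Definition typeP (R : realType) (A : nat) (F : 'I_A -> R -> R) (i : 'I_A) : Prop :=
  condM F i /\ (fun k => ((F i k%:R)%:E * tail F i k)%E) @ \oo --> +oo%E.

Definition typeE (R : realType) (A : nat) (F : 'I_A -> R -> R) (i : 'I_A) : Prop :=
  condM F i /\ (limn_esup (fun k => ((F i k%:R)%:E * tail F i k)%E) < +oo)%E.

Definition feedback (R : realType) (A : nat) (F : 'I_A -> R -> R) : Prop :=
  forall i : 'I_A,
    (forall x : R, 0 < x -> 0 < F i x) /\
    (forall x : R, 0 < x -> derivable (F i) x 1 /\ {for x, continuous (derive1 (F i))}) /\
    (forall n : nat,
       (forall x y : R, 0 < x -> n%:R <= x -> x <= y -> y <= n.+1%:R -> F i x <= F i y)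
    \/ (forall x y : R, 0 < x -> n%:R <= x -> x <= y -> y <= n.+1%:R -> F i y <= F i x)).

Definition ratio_seq (R : realType) (A : nat) (F : 'I_A -> R -> R)
  (chi : 'I_A -> R) (i j : 'I_A) : nat -> \bar R :=
  fun N => (F i (chi i * N%:R) / F j (chi j * N%:R))%:E.

(* Main.v *)
Require Import Defs.
From HB Require Import structures.
From mathcomp Require Import all_boot all_order all_algebra.
From mathcomp Require Import all_classical all_reals all_analysis.
From mathcomp Require Import ring lra zify.
Import Order.TTheory GRing.Theory Num.Theory.
Import numFieldNormedType.Exports.
Local Open Scope classical_set_scope.
Local Open Scope ring_scope.
Set Implicit Arguments. Unset Strict Implicit. Unset Printing Implicit Defensive.

(** For an agent a outside a set B of agents, the probability that B ever wins is
    at most (sum over B of F_b(x_b)) * (sum over l of 1/F_a(x_a + l)): one minus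
    this quantity is subharmonic for the urn killed when an agent of B wins.  With
    a = i and i of type E (so that F_i grows geometrically and its tail sum is
    O(1/F_i)), total monopoly of i follows once F_j(x_j) = o(F_i(x_i)) for every
    j <> i.

    Suppose instead F_j(x_j) >= c F_i(x_i) for infinitely many N.  Move mass t
    from i to j.  The set of small t at which limsup F_j/F_i = oo is then a dense
    G_delta, because F_i loses a geometric factor.  By the ratio hypothesis and
    Baire's theorem, limsup F_i/F_j = oo cannot also hold on a dense G_delta, so
    F_i = O(F_j) uniformly for t in an interval.  Sweeping the resulting cone of
    starting points gives F_i(x_i) * (sum over l of 1/F_j(x_j + l)) <= 1/2 for some
    t, so that agent i never wins with probability at least 1/2 (take B = {i} and
    a = j); this contradicts that D_i contains a neighbourhood of chi. *)

(** * Geometric growth of type E feedback *)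

Lemma limn_esup_lty_bound (R : realType) (u : nat -> \bar R) :
  (limn_esup u < +oo)%E ->
  exists c n0, forall n, (n0 <= n)%N -> (u n <= c%:E)%E.
Proof.
rewrite limn_esup_lim => H.
have [n0 Hn0] : exists n0, (esups u n0 < +oo)%E.
  apply: contrapT => /forallNP Hn.
  have E : esups u = fun=> +oo%E.
    by apply/funext => n; apply/eqP; rewrite eq_le leey leNgt; exact/negP.
  by move: H; rewrite E lim_cst.
have : exists c, (esups u n0 <= c%:E)%E.
  move: Hn0; case: (esups u n0) => [c _|//|_].
  - by exists c.
  - by exists 0; rewrite leNye.
move=> [c Hc]; exists c, n0 => n le_n; apply: le_trans Hc.
by apply: ereal_sup_ubound; exists n.
Qed.

(** The tails cut off at [k + m] satisfy [T a - T a.+1 = G a >= c^-1 * T a], so each shift of the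
    starting index multiplies the tail by at most [1 - c^-1]. The last tail is the single term
    [G (k + m)], and the first is at most [c * G k]. *)
Lemma geometric_decay (R : realType) (G : nat -> R) (c : R) (k0 : nat) :
  (forall k, 0 <= G k) -> 1 < c ->
  (forall k n, (k0 <= k)%N -> \sum_(k <= l < k + n) G l <= c * G k) ->
  forall k m, (k0 <= k)%N -> G (k + m)%N <= c * (1 - c^-1) ^+ m * G k.
Proof.
move=> G0 c1 HG k m k0k.
have c0 : 0 < c by lra.
have q0 : 0 <= 1 - c^-1 by rewrite subr_ge0 invf_le1 // ltW.
set T := fun a => \sum_(a <= l < (k + m).+1) G l.
have Tle a : (k0 <= a)%N -> (a <= (k + m).+1)%N -> T a <= c * G a.
  by move=> k0a ale; rewrite /T -(subnKC ale); exact: HG.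
have Tdecay a : (a <= m)%N -> T (k + a)%N <= (1 - c^-1) ^+ a * T k.
  elim: a => [_|a IH am]; first by rewrite addn0 expr0 mul1r.
  have TS : T (k + a)%N = G (k + a)%N + T (k + a.+1)%N.
    by rewrite /T addnS big_ltn //; lia.
  have := Tle (k + a)%N ltac:(lia) ltac:(lia).
  rewrite -(ler_pM2l (_ : 0 < c^-1)) ?invr_gt0 // mulrA mulVf ?gt_eqF // mul1r => H1.
  apply: le_trans (_ : (1 - c^-1) * T (k + a)%N <= _).
    by move: H1; rewrite TS; lra.
  by rewrite exprS -mulrA ler_wpM2l // IH // ltnW.
have GT : G (k + m)%N = T (k + m)%N by rewrite /T big_nat1.
rewrite GT; apply: le_trans (Tdecay m (leqnn m)) _.
by rewrite mulrAC [leRHS]mulrC ler_wpM2l ?exprn_ge0 // Tle //; lia.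
Qed.

Lemma feedback_gt0 (R : realType) (A : nat) (F : 'I_A -> R -> R) i (n : nat) :
  feedback F -> (0 < n)%N -> 0 < F i n%:R.
Proof. by move=> /(_ i)[+ _] n0; apply; rewrite ltr0n. Qed.

(** Type E bounds the tails of [1 / F i] by a multiple of their first term, so [geometric_decay]
    applies to the reciprocals. *)
Lemma typeE_growth (R : realType) (A : nat) (F : 'I_A -> R -> R) i :
  feedback F -> typeE F i ->
  exists C q, exists k0 : nat, [/\ 0 < C, 0 < q < 1, (0 < k0)%N &
    forall k m, (k0 <= k)%N -> F i k%:R <= C * q ^+ m * F i (k + m)%N%:R].
Proof.
move=> hF [_ /limn_esup_lty_bound[c [n0 Hc]]].
(* Raising the eventual bound [c] above 1 puts the ratio [1 - C^-1] strictly between 0 and 1. *)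
pose C := Num.max c 1 + 1.
have C1 : 1 < C by rewrite /C; have : 1 <= Num.max c 1 by [rewrite le_max lexx orbT]; lra.
have C0 : 0 < C by lra.
exists C, (1 - C^-1), (maxn n0 1); split => //; first 2 last.
(* [feedback] leaves the sign of [F i] at 0 open; the value 0 there keeps [G] nonnegative, and the
   threshold [maxn n0 1] keeps this index out of the sums. *)
- pose G := fun k => if (0 < k)%N then (F i k%:R)^-1 else 0.
  have GE k : (0 < k)%N -> G k = (F i k%:R)^-1 by rewrite /G => ->.
  have G0 k : 0 <= G k.
    by rewrite /G; case: ifP => // k0; rewrite invr_ge0 ltW // feedback_gt0.
  have HG k n : (maxn n0 1 <= k)%N -> \sum_(k <= l < k + n) G l <= C * G k.
    rewrite geq_max => /andP[n0k k0].
    have Fk := feedback_gt0 i hF k0.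
    rewrite GE // ler_pdivlMr // mulrC.
    apply: le_trans (_ : c <= _); last first.
      rewrite /C; have : c <= Num.max c 1 by [rewrite le_max lexx]; lra.
    rewrite -lee_fin; apply: le_trans (Hc _ n0k).
    rewrite EFinM lee_wpmul2l ?lee_fin ?(ltW Fk) //.
    rewrite -sumEFin; apply: le_trans (nneseries_lim_ge (k + n) _).
      rewrite big_nat [leRHS]big_nat; apply: lee_sum => l /andP[kl _].
      by rewrite GE // (leq_trans k0).
    move=> l kl _; rewrite lee_fin invr_ge0 ltW // feedback_gt0 //.
    exact: leq_trans k0 kl.
  move=> k m Hk.
  have k0 : (0 < k)%N by lia.
  have := geometric_decay G0 C1 HG m Hk.
  rewrite !GE; [|lia..].
  have F1 := feedback_gt0 i hF k0.
  have F2 := feedback_gt0 i hF (ltn_addr m k0).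
  by rewrite ler_pdivlMr // mulrC ler_pdivrMr //.
- by rewrite subr_gt0 invf_lt1 // C1 /= gtrBl invr_gt0.
- by rewrite leq_max orbT.
Qed.

(** Monotonicity on the unit interval around [x] puts [F i x] between the values at its two
    endpoints; the direction decides which endpoint serves for which [b]. *)
Lemma feedback_nat_between (R : realType) (A : nat) (F : 'I_A -> R -> R) i (x : R) :
  feedback F -> 1 <= x -> forall b : bool,
  exists n : nat, [/\ x - 1 < n%:R, n%:R <= x + 1 &
    if b then F i x <= F i n%:R else F i n%:R <= F i x].
Proof.
move=> /(_ i)[_ [_ hm]] x1.
have /andP[] := truncn_itv (ltW (lt_le_trans ltr01 x1)).
set n := Num.truncn x => nx xn.
have n1 : (0 < n)%N by rewrite -(ltr_nat R); move: xn; rewrite -natr1; lra.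
have n1R : (1 : R) <= n%:R by rewrite ler1n.
have nS : n.+1%:R = n%:R + 1 :> R by rewrite natr1.
have [up|down] := hm n; case.
- by exists n.+1; split; [lra..|apply: up; lra].
- by exists n; split; [lra..|apply: up; lra].
- by exists n; split; [lra..|apply: down; lra].
- by exists n.+1; split; [lra..|apply: down; lra].
Qed.

(** Rounding gives integers [a <= x + 1] and [b > y - 1]. The extra 1 in the gap yields
    [b > a + m - 1], hence [a + m <= b], and the extra 1 on [k0] yields [k0 <= a]. *)
Lemma typeE_growth_real (R : realType) (A : nat) (F : 'I_A -> R -> R) i C q (k0 : nat) :
  feedback F -> 0 < C -> 0 < q < 1 ->
  (forall k m, (k0 <= k)%N -> F i k%:R <= C * q ^+ m * F i (k + m)%N%:R) ->
  forall (x y : R) (m : nat), k0.+1%:R <= x -> x + m%:R + 1 <= y ->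
  F i x <= C * q ^+ m * F i y.
Proof.
move=> hF C0 /andP[q0 q1] growth x y m k0x xy.
have m0 : 0 <= m%:R :> R by [].
have k00 : 0 <= k0%:R :> R by [].
have kS : k0.+1%:R = k0%:R + 1 :> R by rewrite natr1.
have [|a [xa ax Fa]] := @feedback_nat_between _ _ F i x hF _ true; first lra.
have [|b [yb by_ Fb]] := @feedback_nat_between _ _ F i y hF _ false; first lra.
have k0a : (k0 <= a)%N by rewrite -(ler_nat R); lra.
have amb : (a + m <= b)%N.
  by rewrite -ltnS -(ltr_nat R) natrD -natr1; lra.
have b0 : (0 < b)%N.
  by rewrite -(ltr_nat R); lra.
apply: (le_trans Fa); apply: le_trans (growth a (b - a)%N k0a) _.
rewrite subnKC; last exact: leq_trans (leq_addr _ _) amb.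
apply: ler_pM => //.
- by rewrite mulr_ge0 ?exprn_ge0 // ltW.
- by rewrite ltW // feedback_gt0.
- rewrite ler_pM2l // ler_wiXn2l ?(ltW q0) ?(ltW q1) // leq_subRL //.
  exact: leq_trans (leq_addr _ _) amb.
Qed.

(** * Probability that a set of agents never wins *)

(** There are countably many pairs of states, so the event is a countable union over their
    values. *)
Lemma measurable_state_pred (d : measure_display) (Omega : measurableType d)
  (A : nat) (X : nat -> Omega -> state A) (Q : state A -> state A -> Prop) n m :
  (forall n v, measurable [set w | X n w = v]) ->
  measurable [set w | Q (X n w) (X m w)].
Proof.
move=> mX.
have -> : [set w | Q (X n w) (X m w)] =
    \bigcup_(uv : state A * state A)
      ([set w | X n w = uv.1] `&` [set w | X m w = uv.2] `&` [set _ | Q uv.1 uv.2]).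
  apply/seteqP; split => [w /= Qw|w [[u v] _ /= [[-> ->]]]//].
  by exists (X n w, X m w).
apply: countable_bigcupT_measurable => [|[u v]]; first exact: countableP.
apply: measurableI; first by apply: measurableI; exact: mX.
have [q|q] := pselect (Q u v).
  by rewrite (_ : [set _ | _] = setT) //; apply/seteqP; split.
by rewrite (_ : [set _ | _] = set0) //; apply/seteqP; split.
Qed.

Definition history (A : nat) (Omega : Type) (X : nat -> Omega -> state A)
  (n : nat) (h : nat -> state A) : set Omega :=
  [set w | forall k, (k <= n)%N -> X k w = h k].

(* The condition on the total count rules out, up to time n + m, the null event
   of a step that is not an increment. *)
Definition frozen (A : nat) (Omega : Type) (X : nat -> Omega -> state A)
  (B : pred 'I_A) (v : state A) (n m : nat) : set Omega :=
  [set w | forall k, (n <= k <= n + m)%N ->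
     (forall b, B b -> X k w b = v b) /\
     (\sum_j X k w j = \sum_j v j + (k - n))%N].

Lemma measurable_history (d : measure_display) (Omega : measurableType d)
  (A : nat) (X : nat -> Omega -> state A) n h :
  (forall n v, measurable [set w | X n w = v]) -> measurable (history X n h).
Proof.
move=> mX; rewrite (_ : history _ _ _ =
    \bigcap_(k in [set k | (k <= n)%N]) [set w | X k w = h k]) //.
exact: bigcap_measurableType.
Qed.

Lemma measurable_frozen (d : measure_display) (Omega : measurableType d)
  (A : nat) (X : nat -> Omega -> state A) B v n m :
  (forall n v, measurable [set w | X n w = v]) -> measurable (frozen X B v n m).
Proof.
move=> mX; rewrite (_ : frozen _ _ _ _ _ =
    \bigcap_(k in [set k | (n <= k <= n + m)%N])
      [set w | (forall b, B b -> X k w b = v b) /\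
               (\sum_j X k w j = \sum_j v j + (k - n))%N]) //.
apply: bigcap_measurableType => k _.
exact: (measurable_state_pred (fun u _ => (forall b, B b -> u b = v b) /\
  (\sum_j u j = \sum_j v j + (k - n))%N) k k mX).
Qed.

Lemma incrE (A : nat) (v : state A) c j : incr v c j = (v j + (j == c))%N.
Proof. by rewrite ffunE. Qed.

Lemma sum_incr (A : nat) (v : state A) c : (\sum_j incr v c j = (\sum_j v j).+1)%N.
Proof.
under eq_bigr do rewrite incrE.
rewrite big_split /= -addn1; congr addn.
by rewrite (bigD1 c) //= eqxx big1 // => j /negbTE ->.
Qed.

(** Makes the event in the transition rule of [is_urn] a history again, so that an induction over
    time can continue from it. *)
Lemma history_incr (A : nat) (Omega : Type) (X : nat -> Omega -> state A) n h c :
  history X n.+1 (fun k => if (k <= n)%N then h k else incr (h n) c) =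
  [set w | (forall k, (k <= n)%N -> X k w = h k) /\ X n.+1 w = incr (h n) c].
Proof.
apply/seteqP; split => [w Hw|w [Hw HS] k].
  by split=> [k kn|]; [rewrite Hw ?kn // leqW|rewrite Hw // ltnn].
by rewrite leq_eqVlt ltnS => /orP[/eqP ->|kn]; rewrite ?ltnn // kn Hw.
Qed.

Lemma frozen_incr (A : nat) (Omega : Type) (X : nat -> Omega -> state A)
  (B : pred 'I_A) n m h c : ~~ B c ->
  history X n.+1 (fun k => if (k <= n)%N then h k else incr (h n) c)
    `&` frozen X B (incr (h n) c) n.+1 m
  `<=` history X n h `&` frozen X B (h n) n m.+1.
Proof.
move=> Bc; rewrite history_incr => w [[Hw HS] Fw]; split=> // k /andP[].
rewrite leq_eqVlt => /orP[/eqP <- _|nk kn]; first by rewrite Hw // subnn addn0.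
have [|Fb Fs] := Fw k; first by rewrite nk addSnnS.
split=> [b Bb|]; last by rewrite Fs sum_incr addSnnS -subSn // subSS.
rewrite Fb // incrE (_ : b == c = false) ?addn0 //.
by apply: contraNF Bc => /eqP <-.
Qed.

(* A win of a shortens the sum by its first term, which brings in exactly the
   weight of B lost through the killing. *)
Lemma frozen_subharmonic (R : realType) (A : nat) (F : 'I_A -> R -> R)
  (B : pred 'I_A) (a : 'I_A) (v : state A) m :
  (forall i n, (0 < n)%N -> 0 < F i n%:R) -> (forall j, 0 < v j)%N -> ~~ B a ->
  1 - (\sum_(b | B b) F b (v b)%:R) * \sum_(l < m.+1) (F a (v a + l)%N%:R)^-1 <=
  \sum_(c | ~~ B c) trans_prob F v c *
    (1 - (\sum_(b | B b) F b (incr v c b)%:R) *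
         \sum_(l < m) (F a (incr v c a + l)%N%:R)^-1).
Proof.
move=> F0 v0 Ba.
set f := \sum_(b | B b) _; set U := \sum_(l < m.+1) _.
have f0 : 0 <= f by apply: sumr_ge0 => b _; exact/ltW/F0.
have Fa0 l : 0 < F a (v a + l)%N%:R by apply: F0; rewrite ltn_addr.
have U0 : 0 <= U by apply: sumr_ge0 => l _; rewrite invr_ge0 ltW.
set S := \sum_(j < A) F j (v j)%:R.
have S0 : 0 < S.
  by rewrite /S (bigD1 a) //= ltr_pwDl ?F0 // sumr_ge0 // => j _; exact/ltW/F0.
have SE : S = f + \sum_(c | ~~ B c) F c (v c)%:R by rewrite /S (bigID B).
(* The middle sum equals [((S - f) * (1 - f * U) + f) / S = 1 - f * U + f ^+ 2 * U / S], which
   exceeds the left side by a nonnegative term. The isolated [f] comes from [c = a], whose dropped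
   term is [f / F a (v a)]; for other [c] only the last term of [U] is dropped. *)
apply: le_trans (_ : \sum_(c | ~~ B c)
    S^-1 * (F c (v c)%:R * (1 - f * U) + (if c == a then f else 0)) <= _).
  have Ef : \sum_(c | ~~ B c) (if c == a then f else 0) = f.
    rewrite -big_mkcondr (big_pred1 a) // => c /=.
    by case: eqP => [->|]; rewrite ?Ba ?andbF.
  rewrite -mulr_sumr big_split /= Ef -mulr_suml.
  rewrite [leRHS]mulrC ler_pdivlMr //.
  have := mulr_ge0 f0 (mulr_ge0 f0 U0).
  have -> : \sum_(c | ~~ B c) F c (v c)%:R = S - f by rewrite SE addrC addKr.
  nra.
apply: ler_sum => c Bc; rewrite /trans_prob -/S [_ / S]mulrC -mulrA.
rewrite ler_wpM2l ?invr_ge0 ?(ltW S0) //.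
have -> : \sum_(b | B b) F b (incr v c b)%:R = f.
  apply: eq_bigr => b Bb; rewrite incrE (_ : b == c = false) ?addn0 //.
  by apply: contraNF Bc => /eqP <-.
rewrite incrE [in leRHS]eq_sym; case: eqP => [->|_].
  have -> : U = (F a (v a)%:R)^-1 + \sum_(l < m) (F a (v a + 1 + l)%N%:R)^-1.
    rewrite /U big_ord_recl addn0; congr (_ + _); apply: eq_bigr => l _.
    by rewrite /= /bump leq0n addnA.
  have Fav : F a (v a)%:R != 0 by rewrite gt_eqF // F0.
  rewrite le_eqVlt; apply/orP; left; apply/eqP; field.
  exact: Fav.
rewrite addr0 addn0 ler_wpM2l ?(ltW (F0 _ _ _)) // lerD2l lerN2 ler_wpM2l //.
by rewrite /U big_ord_recr /= lerDl invr_ge0 ltW.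
Qed.

(** Induction on the number of steps, splitting by the next winner outside [B]. Multiplying by the
    probability of the history, instead of conditioning on it, covers null histories as well. *)
Lemma urn_frozen_history (R : realType) (A : nat) (F : 'I_A -> R -> R)
  (d : measure_display) (Omega : measurableType d) (P : probability Omega R)
  (X : nat -> Omega -> state A) x0 (B : pred 'I_A) (a : 'I_A) :
  is_urn F P X x0 -> (forall i n, (0 < n)%N -> 0 < F i n%:R) -> ~~ B a ->
  forall m n (h : nat -> state A), (forall j, 0 < h n j)%N ->
  (P (history X n h) *
    (1 - (\sum_(b | B b) F b (h n b)%:R) *
         \sum_(l < m) (F a (h n a + l)%N%:R)^-1)%:E
   <= P (history X n h `&` frozen X B (h n) n m))%E.
Proof.
move=> [mX [_ HX]] F0 Ba; elim=> [|m IH] n h hn.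
  rewrite big_ord0 mulr0 subr0 mule1 (_ : _ `&` _ = history X n h) //.
  apply/seteqP; split => [w []//|w Hw]; split=> // k.
  by rewrite addn0 -eqn_leq => /eqP <-; rewrite Hw // subnn addn0.
set H := history X n h.
pose hc c := fun k => if (k <= n)%N then h k else incr (h n) c.
have hcn c : hc c n.+1 = incr (h n) c by rewrite /hc ltnn.
(* Agent [c] wins the next step and [B] then stays frozen for [m] more steps. These events are
   disjoint because the state at time [n.+1] determines [c]. *)
pose E c := if B c then set0
  else history X n.+1 (hc c) `&` frozen X B (incr (h n) c) n.+1 m.
have mE c : measurable (E c).
  rewrite /E; case: ifP => // _.
  by apply: measurableI; [exact: measurable_history|exact: measurable_frozen].
have mT : measurable (H `&` frozen X B (h n) n m.+1).
  by apply: measurableI; [exact: measurable_history|exact: measurable_frozen].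
have EX c w : E c w -> X n.+1 w = incr (h n) c.
  by rewrite /E; case: ifP => // _ [/(_ n.+1 (leqnn _))]; rewrite hcn.
have tE : trivIset setT E.
  apply/trivIsetP => c c' _ _ cc'; rewrite -subset0 => w [/EX e1 /EX e2].
  have : incr (h n) c c = incr (h n) c' c by rewrite -e1 -e2.
  by rewrite !incrE eqxx (negbTE cc') => /addnI.
have mU : measurable (\big[setU/set0]_(c < A) E c) by exact: bigsetU_measurable.
apply: le_trans (_ : P (\big[setU/set0]_(c < A) E c) <= _)%E; last first.
  apply: le_measure; rewrite ?inE //.
  apply: (big_ind (fun S => S `<=` _)) => [|S1 S2 H1 H2|c _]; first exact: sub0set.
    by rewrite subUset.
  rewrite /E; case: ifPn => [_|]; [exact: sub0set|exact: frozen_incr].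
rewrite measure_semi_additive_ord //.
have Pfin : P H \is a fin_num by rewrite fin_num_measure //; exact: measurable_history.
rewrite -(fineK Pfin) -EFinM.
apply: le_trans (_ : (\sum_(c < A) (if ~~ B c then fine (P H) * (trans_prob F (h n) c *
    (1 - (\sum_(b | B b) F b (incr (h n) c b)%:R) *
         \sum_(l < m) (F a (incr (h n) c a + l)%N%:R)^-1)) else 0)%:E <= _)%E); last first.
  apply: lee_sum => c _; case: ifPn => Bc; last by [].
  rewrite mulrA !EFinM fineK // -HX -history_incr /E (negbTE Bc).
  by have := IH n.+1 (hc c); rewrite hcn; apply=> j; rewrite incrE ltn_addr.
rewrite sumEFin lee_fin -big_mkcond /= -mulr_sumr ler_wpM2l ?fine_ge0 //.
exact: frozen_subharmonic.
Qed.

(** The events decrease in [m] and the bound is uniform in [m], so continuity from above carries it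
    to the infinite horizon. *)
Lemma urn_frozen (R : realType) (A : nat) (F : 'I_A -> R -> R)
  (d : measure_display) (Omega : measurableType d) (P : probability Omega R)
  (X : nat -> Omega -> state A) x0 (B : pred 'I_A) (a : 'I_A) eps :
  is_urn F P X x0 -> (forall i n, (0 < n)%N -> 0 < F i n%:R) -> ~~ B a ->
  (forall j, 0 < x0 j)%N ->
  (forall m, (\sum_(b | B b) F b (x0 b)%:R) *
     \sum_(l < m) (F a (x0 a + l)%N%:R)^-1 <= eps) ->
  ((1 - eps)%:E <= P (\bigcap_m frozen X B x0 0 m))%E.
Proof.
move=> urn F0 Ba x00 Heps.
have mX := urn.1.
have mf m : measurable (frozen X B x0 0 m) by exact: measurable_frozen.
have Hm m : ((1 - eps)%:E <= P (frozen X B x0 0 m))%E.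
  apply: le_trans (_ : P (history X 0 (fun=> x0) `&` frozen X B x0 0 m) <= _)%E.
    apply: le_trans (urn_frozen_history urn F0 Ba m (n := 0) (h := fun=> x0) x00).
    rewrite (_ : history _ _ _ = [set w | X 0%N w = x0]); last first.
      by apply/seteqP; split => [w /(_ 0%N (leqnn _))//|w Hw k]; rewrite leqn0 => /eqP ->.
    by rewrite urn.2.1 mul1e lee_fin lerB.
  apply: le_measure; last by move=> w [].
    by rewrite inE; apply: measurableI => //; exact: measurable_history.
  by rewrite inE.
have cvgP : (P \o frozen X B x0 0) @ \oo --> P (\bigcap_m frozen X B x0 0 m).
  apply: nonincreasing_cvg_mu => //.
  - by rewrite ltey_eq fin_num_measure.
  - exact: bigcap_measurableType.
  - move=> m m' mm'; apply/subsetPset => w Hw k Hk; apply: Hw; lia.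
rewrite -(cvg_lim _ cvgP) //; apply: lime_ge; first by apply/cvg_ex; eexists; exact: cvgP.
by near=> m; exact: Hm.
Unshelve. all: by end_near. Qed.

(** * Mass transfer between two agents *)

Lemma limn_esup_pinfty (R : realType) (u : nat -> \bar R) :
  (forall k, exists2 N, (k <= N)%N & (k%:R%:E < u N)%E) ->
  limn_esup u = +oo%E.
Proof.
move=> Hu; apply/eqP; rewrite eq_le leey leNgt; apply/negP.
move=> /limn_esup_lty_bound[c [n0 Hc]].
have [N] := Hu (maxn n0 (Num.truncn `|c|).+1).
rewrite geq_max => /andP[n0N _].
apply/negP; rewrite -leNgt; apply: le_trans (Hc _ n0N) _.
rewrite lee_fin (le_trans (ler_norm c)) //.
have /andP[_ /ltW h] := truncn_itv (normr_ge0 c).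
by apply: (le_trans h); rewrite ler_nat leq_maxr.
Qed.

Lemma limn_einf_eq0 (R : realType) (u : nat -> \bar R) n0 :
  (forall n, (n0 <= n)%N -> (0 <= u n)%E) ->
  (forall k, exists2 N, (k <= N)%N & (u N < (k.+1%:R^-1)%:E)%E) ->
  limn_einf u = 0%E.
Proof.
move=> u0 Hu; rewrite limn_einf_lim; apply: lim_near_cst => //.
exists n0 => // n /= n0n; apply/eqP; rewrite eq_le; apply/andP; split; last first.
  by apply: le_ereal_inf_tmp => _ [m /= nm <-]; apply: u0; exact: leq_trans nm.
apply/lee_addgt0Pr => e e0; rewrite add0e.
have [N HN HuN] := Hu (maxn n (Num.truncn e^-1)).
apply: le_trans (_ : u N <= _)%E.
  by apply: ereal_inf_lbound; exists N => //=; exact: leq_trans (leq_maxl _ _) HN.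
apply: (le_trans (ltW HuN)); rewrite lee_fin -[leRHS]invrK lef_pV2 ?posrE ?invr_gt0 //.
have ei : 0 < e^-1 by rewrite invr_gt0.
have /andP[_ /ltW h] := truncn_itv (ltW ei).
by apply: (le_trans h); rewrite ler_nat ltnS leq_maxr.
Qed.

(** If no [V k] misses a subinterval, then every [V k] is dense in [[0, e]] as every [U k] is, and
    Baire's theorem gives a common point. *)
Lemma baire_interval (R : realType) (e : R) (U V : nat -> set R) :
  0 < e -> (forall k, open (U k)) -> (forall k, open (V k)) ->
  (forall k a b, 0 <= a -> a < b -> b <= e -> exists2 t, a < t < b & U k t) ->
  (exists2 t, 0 < t < e & forall k, U k t /\ V k t) \/
  (exists k a b, [/\ 0 <= a, a < b, b <= e & forall t, a < t < b -> ~ V k t]).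
Proof.
move=> e0 oU oV dU.
have [|nV] := pselect (exists k a b,
  [/\ 0 <= a, a < b, b <= e & forall t, a < t < b -> ~ V k t]); [by right|left].
have dV k a b : 0 <= a -> a < b -> b <= e -> exists2 t, a < t < b & V k t.
  move=> a0 ab be; apply: contrapT => H; apply: nV; exists k, a, b.
  by split=> // t tab Vt; apply: H; exists t.
(* Adding the complement of [[0, e]] makes these sets dense in the whole line; testing density
   against []0, e[] brings the common point back inside. *)
pose W k : set R := (`]0, e[%classic `&` (U k `&` V k)) `|` ~` `[0, e]%classic.
have near_sub (O : set R) x a b : 0 <= a -> a < b -> b <= e -> open O -> O x ->
    a <= x <= b -> exists a' b', [/\ a <= a', a' < b', b' <= b &
      forall s, a' < s < b' -> O s].
  move=> a0 ab be oO Ox /andP[ax xb].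
  have /nbhs_ballP[r /= r0 Hr] : nbhs x O by exact: open_nbhs_nbhs.
  exists (Num.max a (x - r)), (Num.min b (x + r)); split.
  - by rewrite le_max lexx.
  - by rewrite lt_min !gt_max ab /=; apply/andP; split; [lra|apply/andP; split; lra].
  - by rewrite ge_min lexx.
  - move=> s; rewrite gt_max lt_min => /andP[/andP[_ h1] /andP[_ h2]].
    by apply: Hr; rewrite /ball /= ltr_norml; apply/andP; split; lra.
have : dense (\bigcap_k W k).
  apply: (@Baire R R^o) => k; split.
    apply: openU; last by apply: closed_openC; exact: interval_closed.
    by apply: openI; [exact: interval_open|exact: openI].
  move=> O [x Ox] oO.
  have [xe|xe] := pselect (0 <= x <= e); last first.
    by exists x; split => //; right; rewrite /= in_itv.
  have [a [b [a0 ab be HO]]] := near_sub O x 0 e (lexx _) e0 (lexx _) oO Ox xe.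
  have [t tab Ut] := dU k a b a0 ab be.
  have [|a' [b' [aa' ab' bb' HU]]] := near_sub (U k) t a b a0 ab be (oU k) Ut.
    by case/andP: tab => *; apply/andP; split; exact: ltW.
  have [s /andP[a's sb'] Vs] := dV k a' b' (le_trans a0 aa') ab' (le_trans bb' be).
  exists s; split; first by apply: HO; apply/andP; split; lra.
  left; split; first by rewrite /= in_itv /=; apply/andP; split; lra.
  by split => //; apply: HU; apply/andP.
move=> /(_ `]0, e[%classic) [].
- by exists (e / 2); rewrite /= in_itv /=; apply/andP; split; lra.
- exact: interval_open.
move=> t [te Wt]; exists t; first by move: te; rewrite /= in_itv.
move=> k; have [[]//|] := Wt k I.
move: te; rewrite /= !in_itv /= => /andP[t0 te] []; apply/andP; split; exact: ltW.
Qed.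

Definition natceil (R : realType) (x : R) : nat := `|Num.ceil x|%N.

Lemma natceil_itv (R : realType) (x : R) : 0 <= x ->
  x <= (natceil x)%:R < x + 1.
Proof.
move=> x0; have := ceil_itv x.
have -> : Num.ceil x = (natceil x)%:Z by rewrite /natceil gez0_abs // ceil_ge0; lra.
by rewrite intrB -!pmulrn => /andP[h1 ->] /=; lra.
Qed.

Lemma near_linear (R : realType) (p r : R) : 0 < p ->
  \forall n \near \oo, r <= p * n%:R.
Proof.
move=> p0; have := nbhs_infty_ger (r / p); apply: filterS => n.
by rewrite ler_pdivrMr // mulrC.
Qed.

(** Each power of [q] occurs at most [p] times. Extending the sum to [m * p] terms makes all blocks
    complete, and the geometric sum is then exact. *)
Lemma sum_expr_div_bounded (R : realType) (q : R) (p : nat) :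
  0 < q < 1 -> (0 < p)%N ->
  forall m, \sum_(l < m) q ^+ (l %/ p) <= p%:R / (1 - q).
Proof.
move=> /andP[q0 q1] p0 m; rewrite ler_pdivlMr ?subr_gt0 //.
have E n : (\sum_(l < n * p) q ^+ (l %/ p)) * (1 - q) = p%:R * (1 - q ^+ n).
  elim: n => [|n IH]; first by rewrite mul0n big_ord0 expr0; ring.
  rewrite mulSn addnC big_split_ord /= mulrDl IH.
  under [X in _ + X * _]eq_bigr => i _ do rewrite divnMDl // divn_small // addn0.
  by rewrite sumr_const card_ord exprS -mulr_natl; ring.
apply: le_trans (_ : (\sum_(l < m * p) q ^+ (l %/ p)) * (1 - q) <= _).
  rewrite ler_pM2r ?subr_gt0 //.
  rewrite -(subnKC (leq_pmulr m p0)) big_split_ord /= lerDl.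
  by apply: sumr_ge0 => i _; rewrite exprn_ge0 // ltW.
by rewrite E ler_piMr // gerBl exprn_ge0 // ltW.
Qed.

(* Rounding y / (beta + s0) up to an integer N moves s0 to t by O(1/N). *)
Lemma ray_hit (R : realType) (beta a s0 y : R) :
  0 < beta -> 0 <= a -> a < s0 -> (beta + a) * (beta + s0) <= (s0 - a) * y ->
  exists (N : nat) t, [/\ a < t <= s0, (0 < N)%N, (beta + t) * N%:R = y &
    y <= (beta + s0) * N%:R < y + (beta + s0)].
Proof.
move=> b0 a0 as0 Hy.
have ba0 : 0 < beta + a by lra.
have s0' : 0 < beta + s0 by lra.
have y0 : 0 < y.
  by rewrite -(pmulr_rgt0 _ (_ : 0 < s0 - a)) ?subr_gt0 // (lt_le_trans _ Hy) ?mulr_gt0.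
have /andP[] := natceil_itv (ltW (divr_gt0 y0 s0')).
set N := natceil _.
rewrite ler_pdivrMr // -(ltr_pM2r s0') mulrDl divfK ?gt_eqF // mul1r.
rewrite ![N%:R * _]mulrC => yN Ny.
have N0 : 0 < N%:R :> R by rewrite -(pmulr_rgt0 _ s0'); lra.
exists N, (y / N%:R - beta); split.
- apply/andP; split.
    rewrite ltrBrDl ltr_pdivlMr // -(ltr_pM2l s0').
    apply: lt_le_trans (_ : (beta + a) * (y + (beta + s0)) <= _).
      by rewrite mulrCA ltr_pM2l.
    by lra.
  by rewrite lerBlDl ler_pdivrMr.
- by rewrite -(ltr_nat R).
- by rewrite addrC subrK divfK // gt_eqF.
- by rewrite yN.
Qed.

Lemma exists_expr_lt (R : realType) (q eps : R) :
  0 < q < 1 -> 0 < eps -> exists m, q ^+ m < eps.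
Proof.
move=> /andP[q0 q1] e0.
have qn : `|q| < 1 by rewrite gtr0_norm.
by have [m] := filter_ex (cvgr_lt _ (cvg_expr qn) _ e0); exists m.
Qed.

(** A union over [N] of sets that are open by continuity. The index [k] bounds both [N] and the
    ratio from below, so a point lying in these sets for all [k] has unbounded ratios
    [psi N / phi N] along arbitrarily large [N]. *)
Lemma open_eventually_lt (R : realType) (e : R) (phi psi : nat -> R -> R) (k : nat) :
  (forall N t, (0 < N)%N -> 0 < t < e ->
     {for t, continuous (phi N)} /\ {for t, continuous (psi N)}) ->
  open [set t | 0 < t < e /\
    exists2 N, (k < N)%N & k.+1%:R * phi N t < psi N t].
Proof.
move=> Hc; rewrite openE => t [te [N kN lt_t]].
have [cphi cpsi] := Hc N t (leq_ltn_trans (leq0n k) kN) te.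
have ch : {for t, continuous (fun s => psi N s - k.+1%:R * phi N s)}.
  by apply: cvgB => //; apply: cvgMr.
have ht : 0 < psi N t - k.+1%:R * phi N t by rewrite subr_gt0.
have near_te : \forall s \near t, 0 < s < e.
  have : nbhs t `]0, e[%classic.
    by apply: open_nbhs_nbhs; split; [exact: interval_open|rewrite /= in_itv].
  by apply: filterS => s; rewrite /= in_itv.
near=> s; split; first by near: s.
exists N => //; rewrite -subr_gt0; near: s.
exact: (cvgr_gt _ ch _ ht).
Unshelve. all: by end_near. Qed.

(** Keep the argument [y] of [g] fixed and choose [N] and [t] near [s0] with [(beta + t) * N = y].
    The argument of [f] becomes [sigma * N - y], which is below its old value by an amount linear in
    [M], so geometric growth makes [f] smaller by any prescribed factor. *)
Lemma ray_dense (R : realType) (f g : R -> R) (alpha beta e c C q K : R) (k : nat) :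
  0 < e < alpha -> 0 < beta -> 0 < c -> 0 < C -> 0 < q < 1 ->
  (forall x, 0 < x -> 0 < f x) ->
  (forall x y (m : nat), K <= x -> x + m%:R + 1 <= y -> f x <= C * q ^+ m * f y) ->
  (forall M0, exists2 M, (M0 <= M)%N &
     c * f (natceil (alpha * M%:R))%:R <= g (natceil (beta * M%:R))%:R) ->
  forall a b, 0 <= a -> a < b -> b <= e ->
  exists2 t, a < t < b & exists2 N, (k < N)%N &
    k.+1%:R * f ((alpha - t) * N%:R) < g ((beta + t) * N%:R).
Proof.
move=> /andP[e0 ea] b0 c0 C0 q01 f0 growth Hbig a b a0 ab be.
have k0 : 0 < k.+1%:R :> R by [].
(* A gap of [m] between the arguments of [f] is enough to beat both the factor [k.+1] and the
   constant [c]. *)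
have [m Hm] := exists_expr_lt q01 (divr_gt0 c0 (mulr_gt0 k0 C0)).
have {}Hm : k.+1%:R * (C * q ^+ m) < c.
  by move: Hm; rewrite ltr_pdivlMr ?mulr_gt0 // mulrC mulrA.
pose s0 := (a + b) / 2; pose s := beta + s0; pose sigma := alpha + beta.
have as0 : a < s0 by rewrite /s0; lra.
have s0b : s0 < b by rewrite /s0; lra.
have sp : 0 < s by rewrite /s; lra.
(* In order: the hypothesis of [ray_hit], the threshold [K] for growth, [k < N], and a gap of at
   least [m + 1] after rounding, multiplied by [s]. *)
have [M0 _ HM0] : \forall M \near \oo,
    [/\ (beta + a) * s <= (s0 - a) * beta * M%:R,
        K * s <= (alpha - e) * beta * M%:R,
        (k.+1)%:R * s <= beta * M%:R &
        (sigma - s) + sigma * s + s * (m%:R + 1) <= s0 * sigma * M%:R].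
  near=> M; split; near: M; apply: near_linear.
  - by rewrite mulr_gt0 // subr_gt0.
  - by rewrite mulr_gt0 // subr_gt0.
  - by [].
  - by rewrite mulr_gt0 // /sigma; lra.
have [M M0M HM] := Hbig M0; have [H1 H2 H3 H4] := HM0 M M0M.
have M0R : 0 <= M%:R :> R by [].
have /andP[yM My] := natceil_itv (mulr_ge0 (ltW b0) M0R).
have /andP[xM _] := natceil_itv (mulr_ge0 (ltW (lt_trans e0 ea)) M0R).
move: HM yM My xM; set y := (natceil (beta * M%:R))%:R.
set x := (natceil (alpha * M%:R))%:R => HM yM My xM.
have [|N [t [/andP[at_ ts0] N0 hit /andP[yN Ny]]]] := @ray_hit _ beta a s0 y b0 a0 as0.
  apply: (le_trans H1); rewrite -mulrA ler_wpM2l // subr_ge0; exact: ltW.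
exists t; first by rewrite at_; lra.
have NR0 : 0 < N%:R :> R by rewrite ltr0n.
exists N.
  rewrite -(ltr_nat R) -(ltr_pM2l sp).
  by move: H3; rewrite -natr1; rewrite -/s in yN; lra.
rewrite hit; apply: lt_le_trans HM.
have hx : (alpha - t) * N%:R = sigma * N%:R - y by rewrite -hit /sigma; ring.
apply: le_lt_trans (_ : k.+1%:R * (C * q ^+ m * f x) < _); last first.
  rewrite mulrA ltr_pM2r // f0 //.
  apply: lt_le_trans xM; apply: mulr_gt0; first lra.
  rewrite lt_neqAle M0R andbT eq_sym; apply/eqP => M00.
  by move: H3; rewrite M00 mulr0 leNgt mulr_gt0.
rewrite ler_wpM2l // growth //.
  rewrite -(ler_pM2r sp); apply: (le_trans H2).
  apply: le_trans (_ : (alpha - e) * y <= _).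
    by rewrite -mulrA ler_wpM2l // subr_ge0 ltW.
  apply: le_trans (_ : (alpha - e) * (s * N%:R) <= _).
    by rewrite ler_wpM2l // subr_ge0 ltW.
  rewrite -mulrA [N%:R * s]mulrC ler_wpM2r ?mulr_ge0 ?(ltW sp) ?(ltW NR0) //; lra.
(* Multiplication by [s] replaces [s * N] by [y] up to an error below [s]. The linear gain is [s *
   alpha - (sigma - s) * beta = s0 * sigma] per unit of [M]. *)
rewrite hx -(ler_pM2l sp).
have h1 : sigma * (s * N%:R) <= sigma * (y + s).
  by rewrite ler_wpM2l // /sigma; [lra|exact: ltW].
have h2 : (sigma - s) * y <= (sigma - s) * (beta * M%:R + 1).
  by rewrite ler_wpM2l //; [rewrite /sigma /s; lra|exact: ltW].
have h3 : s * (alpha * M%:R) <= s * x by rewrite ler_wpM2l // ltW.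
have h4 : s * (alpha * M%:R) - (sigma - s) * (beta * M%:R) = s0 * sigma * M%:R.
  by rewrite /sigma /s; ring.
move: h1 h2 h3 h4 H4; clear; lra.
Unshelve. all: by end_near. Qed.

(** By [ray_hit] each integer [y + l] equals [(beta + t) * N'] with [a < t <= s0], so [g] there is
    at least [f ((alpha - t) * N') / k.+1]. That argument of [f] exceeds [x] by at least
    [L + l %/ p + 1], so the terms are dominated by a geometric series with a small factor
    [q ^+ L]. *)
Lemma natceil_ray_sum_le (R : realType) (f g : R -> R) (alpha beta e C q K : R)
  (k : nat) (a b : R) :
  0 < e < alpha -> 0 < beta -> 0 < C -> 0 < q < 1 ->
  (forall x, 0 < x -> 0 < f x) -> (forall x, 0 < x -> 0 < g x) ->
  (forall x y (m : nat), K <= x -> x + m%:R + 1 <= y -> f x <= C * q ^+ m * f y) ->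
  0 <= a -> a < b -> b <= e ->
  (forall t N, a < t < b -> (k < N)%N ->
    f ((alpha - t) * N%:R) <= k.+1%:R * g ((beta + t) * N%:R)) ->
  exists2 t, 0 < t < e & \forall N \near \oo, forall m,
    f (natceil ((alpha - t) * N%:R))%:R *
      \sum_(l < m) (g (natceil ((beta + t) * N%:R) + l)%N%:R)^-1 <= 2^-1.
Proof.
move=> /andP[e0 ea] b0 C0 q01 f0 g0 growth a0 ab be Hdom.
have /andP[q0 q1] := q01.
(* The sum starts on the ray of [ts], while the comparison points lie on rays with [t <= s0 < ts],
   where the coordinate for [f] is at least [r] times the one for [g]. *)
pose s0 := (2 * a + b) / 3; pose ts := (a + 2 * b) / 3.
pose s := beta + s0; pose sigma := alpha + beta; pose r := (alpha - s0) / s.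
have as0 : a < s0 by rewrite /s0; lra.
have s0t : s0 < ts by rewrite /s0 /ts; lra.
have tsb : ts < b by rewrite /ts; lra.
have sp : 0 < s by rewrite /s; lra.
have r0 : 0 < r by apply: divr_gt0 => //; lra.
have rs : r * s = alpha - s0 by rewrite /r divfK // gt_eqF.
(* With [p > 1 / r], the growth [r * l] of the argument of [f] is at least [l %/ p]. *)
pose p := (Num.truncn r^-1).+1.
have rp : r^-1 < p%:R.
  have ri : 0 < r^-1 by rewrite invr_gt0.
  by have /andP[] := truncn_itv (ltW ri).
have div_le l : (l %/ p)%:R <= r * l%:R :> R.
  rewrite -(ler_pM2l (_ : 0 < r^-1)) ?invr_gt0 // mulKf ?gt_eqF //.
  apply: le_trans (_ : p%:R * (l %/ p)%:R <= _).
    by rewrite ler_wpM2r // ltW.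
  by rewrite -natrM ler_nat mulnC leq_trunc_div.
pose D := p%:R / (1 - q).
have D0 : 0 < D by rewrite divr_gt0 // subr_gt0.
have k0 : 0 < k.+1%:R :> R by [].
have P0 : 0 < C * k.+1%:R * D by apply: mulr_gt0 => //; exact: mulr_gt0.
have [L HL] : exists L, q ^+ L < (2 * (C * k.+1%:R * D))^-1.
  by apply: exists_expr_lt => //; rewrite invr_gt0 mulr_gt0.
have {}HL : C * k.+1%:R * D * q ^+ L <= 2^-1.
  move: HL; rewrite invfM ltr_pdivlMr // => /ltW.
  by rewrite mulrC.
(* The gap, per unit of [N], between the rays of [s0] and [ts] above the same coordinate for [g]. *)
pose rho := r * (beta + ts) - (alpha - ts).
have rho0 : 0 < rho.
  rewrite -(pmulr_rgt0 _ sp).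
  have -> : s * rho = (alpha - s0) * (beta + ts) - s * (alpha - ts).
    by rewrite /rho -rs; ring.
  have -> : (alpha - s0) * (beta + ts) - s * (alpha - ts) = (ts - s0) * sigma.
    by rewrite /s /sigma; ring.
  by rewrite mulr_gt0 ?subr_gt0 // /sigma; lra.
exists ts.
  by rewrite (lt_trans (le_lt_trans a0 as0) s0t) (lt_le_trans tsb be).
(* In the fourth condition, the 2 pays for rounding [x] up and for the margin 1 in the growth
   hypothesis. *)
have : \forall N \near \oo,
    [/\ (beta + a) * s <= (s0 - a) * beta * N%:R,
        K <= (alpha - ts) * N%:R,
        k.+1%:R * s <= beta * N%:R,
        L%:R + 2 <= rho * N%:R & 1 <= (alpha - ts) * N%:R].
  near=> N; split; near: N; apply: near_linear.
  - by rewrite mulr_gt0 // subr_gt0.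
  - by lra.
  - by [].
  - by [].
  - by lra.
apply: filterS => N [H1 H2 H3 H4 H5] m.
have N0R : 0 <= N%:R :> R by [].
have at0 : 0 < alpha - ts by lra.
have bt0 : 0 < beta + ts by lra.
have /andP[yN _] := natceil_itv (mulr_ge0 (ltW bt0) N0R).
have /andP[xN Nx] := natceil_itv (mulr_ge0 (ltW at0) N0R).
set y := natceil ((beta + ts) * N%:R) in yN *.
set x := (natceil ((alpha - ts) * N%:R))%:R in xN Nx *.
have betay : beta * N%:R <= y%:R by apply: le_trans yN; rewrite ler_wpM2r //; lra.
have x0 : 0 < x by lra.
have term l : f x * (g (y + l)%N%:R)^-1 <= C * k.+1%:R * q ^+ L * q ^+ (l %/ p).
  have yl0 : 0 <= l%:R :> R by [].
  have ylp : 0 < (y + l)%N%:R :> R.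
    rewrite natrD; have : 0 < k.+1%:R * s by rewrite mulr_gt0.
    by lra.
  have [|N' [t [/andP[at_ ts0] N'0 hit /andP[yN' _]]]] :=
      @ray_hit _ beta a s0 (y + l)%N%:R b0 a0 as0.
    apply: (le_trans H1); rewrite -mulrA ler_wpM2l ?subr_ge0 ?(ltW as0) //.
    by rewrite natrD; lra.
  have kN' : (k < N')%N.
    rewrite -(ltr_nat R) -(ltr_pM2l sp).
    move: H3; rewrite -natr1 => H3.
    by rewrite natrD -/s in yN'; lra.
  have Hd := Hdom t N' ltac:(lra) kN'.
  rewrite ler_pdivrMr ?g0 //.
  apply: le_trans (_ : C * q ^+ (L + l %/ p) * f ((alpha - t) * N'%:R) <= _).
    apply: growth; first exact: le_trans xN.
    have -> : (alpha - t) * N'%:R = sigma * N'%:R - (y + l)%N%:R.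
      by rewrite -hit /sigma; ring.
    have h1 : r * (y + l)%N%:R <= sigma * N'%:R - (y + l)%N%:R.
      have -> : sigma * N'%:R = (r + 1) * (s * N'%:R).
        rewrite mulrA; congr (_ * _).
        by rewrite mulrDl rs mul1r /s /sigma; ring.
      have := ler_wpM2l (ltW (addr_gt0 r0 ltr01)) yN'.
      by rewrite -/s; lra.
    have h2 := ler_wpM2l (ltW r0) yN.
    have h3 : r * ((beta + ts) * N%:R) - (alpha - ts) * N%:R = rho * N%:R.
      by rewrite /rho; ring.
    have h4 := div_le l.
    move: h1 h2 h3 h4 H4 Nx; rewrite !natrD; clear; lra.
  have c0 : 0 <= C * q ^+ (L + l %/ p) by rewrite mulr_ge0 ?exprn_ge0 // ltW.
  apply: (le_trans (ler_wpM2l c0 Hd)); rewrite exprD.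
  by rewrite hit le_eqVlt; apply/orP; left; apply/eqP; ring.
rewrite mulr_sumr.
apply: le_trans (_ : \sum_(l < m) C * k.+1%:R * q ^+ L * q ^+ (l %/ p) <= _).
  by apply: ler_sum => l _; exact: term.
rewrite -mulr_sumr; apply: le_trans HL.
rewrite [leRHS]mulrAC ler_wpM2l //.
  by rewrite !mulr_ge0 ?exprn_ge0 // ltW.
exact: sum_expr_div_bounded.
Unshelve. all: by end_near. Qed.

(** * Monopoly *)

Definition shift (R : realType) (A : nat) (chi : 'I_A -> R) i j t : 'I_A -> R :=
  fun m => chi m - t * (m == i)%:R + t * (m == j)%:R.

Lemma open_simplex_shift (R : realType) (A : nat) (chi : 'I_A -> R) i j t :
  @open_simplex R A chi -> j != i -> 0 < t < chi i ->
  [/\ @open_simplex R A (shift chi i j t),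
      shift chi i j t i = chi i - t, shift chi i j t j = chi j + t &
      forall m, `|shift chi i j t m - chi m| <= t].
Proof.
move=> [chi0 chi1] ji /andP[t0 ti]; set chi' := shift _ _ _ _.
have chi'i : chi' i = chi i - t.
  by rewrite /chi' /shift eqxx eq_sym (negbTE ji) mulr1 mulr0 addr0.
have chi'j : chi' j = chi j + t.
  by rewrite /chi' /shift eqxx (negbTE ji) mulr1 mulr0 subr0.
have chi'm m : m != i -> m != j -> chi' m = chi m.
  by move=> /negbTE mi /negbTE mj; rewrite /chi' /shift mi mj !mulr0 subr0 addr0.
split=> //.
- split=> [m|].
    have [->|mi] := eqVneq m i; first by rewrite chi'i subr_gt0.
    have [->|mj] := eqVneq m j; first by rewrite chi'j addr_gt0.
    by rewrite chi'm.
  rewrite big_split big_split /= chi1 sumrN -!mulr_sumr.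
  have delta (l : 'I_A) : \sum_m (m == l)%:R = 1 :> R.
    by rewrite (bigD1 l) //= eqxx big1 ?addr0 // => m /negbTE ->.
  by rewrite !delta; ring.
- move=> m; have [->|mi] := eqVneq m i.
    by rewrite chi'i addrAC subrr add0r normrN gtr0_norm.
  have [->|mj] := eqVneq m j; first by rewrite chi'j addrAC subrr add0r gtr0_norm.
  by rewrite chi'm // subrr normr0 ltW.
Qed.

Lemma startE (R : realType) (A : nat) (chi : 'I_A -> R) N j :
  start chi N j = natceil (chi j * N%:R).
Proof. by rewrite ffunE. Qed.

Lemma start_gt0 (R : realType) (A : nat) (chi : 'I_A -> R) N j :
  0 < chi j -> (0 < N)%N -> (0 < start chi N j)%N.
Proof.
move=> c0 N0; have cN : 0 < chi j * N%:R by rewrite mulr_gt0 // ltr0n.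
have /andP[h _] := natceil_itv (ltW cN).
by rewrite startE -(ltr_nat R); exact: lt_le_trans h.
Qed.

Lemma measurable_sMon (d : measure_display) (Omega : measurableType d)
  (A : nat) (X : nat -> Omega -> state A) i :
  (forall n v, measurable [set w | X n w = v]) -> measurable (sMon X i).
Proof.
move=> mX; rewrite (_ : sMon X i =
    \bigcup_m \bigcap_(n in [set n | (m <= n)%N]) [set w |
      (\sum_(j < A | j != i) X n w j = \sum_(j < A | j != i) X m w j)%N]).
  apply: bigcupT_measurable => m; apply: bigcap_measurableType => n _.
  exact: (measurable_state_pred (fun u v =>
    (\sum_(j < A | j != i) u j = \sum_(j < A | j != i) v j)%N) n m mX).
by apply/seteqP; split => [w [m Hm]|w [m _ Hm]]; exists m.
Qed.

Lemma measurable_tMon (d : measure_display) (Omega : measurableType d)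
  (A : nat) (X : nat -> Omega -> state A) i :
  (forall n v, measurable [set w | X n w = v]) -> measurable (tMon X i).
Proof.
move=> mX; rewrite (_ : tMon X i = \bigcap_n [set w |
    forall j, j != i -> X n w j = X 0%N w j]).
  apply: bigcap_measurableType => n _.
  exact: (measurable_state_pred (fun u v => forall j, j != i -> u j = v j) n 0%N mX).
by apply/seteqP; split => [w Hw n _|w Hw n]; exact: Hw.
Qed.

(** [frozen] makes the total count rise by one per step; with agent [i] fixed, all of this rise
    falls on the other agents. *)
Lemma frozen_not_sMon (A : nat) (d : measure_display) (Omega : measurableType d)
  (X : nat -> Omega -> state A) i x0 :
  (\bigcap_m frozen X (pred1 i) x0 0 m) `<=` ~` sMon X i.
Proof.
move=> w Hw [m Hm].
have S k : (x0 i + \sum_(j < A | j != i) X k w j = \sum_j x0 j + k)%N.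
  have [|/(_ i (eqxx _)) Fi Fs] := Hw k I k; first by rewrite leq0n add0n leqnn.
  by rewrite subn0 in Fs; rewrite -Fs [in RHS](bigD1 i) //= Fi.
by have := S m.+1; rewrite Hm ?leqnSn // S addnS => /n_Sn.
Qed.

Lemma frozen_sub_tMon (A : nat) (d : measure_display) (Omega : measurableType d)
  (X : nat -> Omega -> state A) i x0 :
  (\bigcap_m frozen X (predC1 i) x0 0 m) `<=` tMon X i.
Proof.
move=> w Hw n j ji.
have [|Fn _] := Hw n I n; first by rewrite leq0n add0n leqnn.
have [|F0 _] := Hw 0%N I 0%N; first by [].
by rewrite Fn // F0.
Qed.

Lemma continuous_ray (R : realType) (f : R -> R) (u v t : R) (N : nat) :
  (0 < N)%N -> (forall x, 0 < x -> {for x, continuous f}) -> 0 < u + v * t ->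
  {for t, continuous (fun s => f ((u + v * s) * N%:R))}.
Proof.
move=> N0 cf ut.
apply: (@continuous_comp _ _ _ (fun s : R => (u + v * s) * N%:R) f).
  by apply: cvgMl; apply: cvgD; [exact: cvg_cst|apply: cvgMr; exact: cvg_id].
by apply: cf; rewrite mulr_gt0 // ltr0n.
Qed.

Lemma feedback_continuous (R : realType) (A : nat) (F : 'I_A -> R -> R) i :
  feedback F -> forall x, 0 < x -> {for x, continuous (F i)}.
Proof.
move=> /(_ i)[_ [+ _]] x x0 => /(_ x x0)[/derivable1_diffP dF _].
exact: differentiable_continuous.
Qed.

Lemma ray_dominated (R : realType) (A : nat) (F : 'I_A -> R -> R) i j
  (chi : 'I_A -> R) (e c : R) :
  feedback F -> typeE F i -> j != i -> @open_simplex R A chi -> 0 < e < chi i ->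
  0 < c ->
  (forall chi, @open_simplex R A chi ->
     ~ (limn_einf (ratio_seq F chi i j) = 0%E /\
        limn_esup (ratio_seq F chi i j) = +oo%E)) ->
  (forall M0, exists2 M, (M0 <= M)%N &
    c * F i (natceil (chi i * M%:R))%:R <= F j (natceil (chi j * M%:R))%:R) ->
  exists2 t, 0 < t < e & \forall N \near \oo, forall m,
    F i (natceil ((chi i - t) * N%:R))%:R *
      \sum_(l < m) (F j (natceil ((chi j + t) * N%:R) + l)%N%:R)^-1 <= 2^-1.
Proof.
move=> hF tE ji chiS echi c0 Hratio Hbig.
have [chi0 _] := chiS; have /andP[e0 ei] := echi.
have [C [q [k0 [C0 q01 k00 growthN]]]] := typeE_growth hF tE.
have growth := typeE_growth_real hF C0 q01 growthN.
have Fpos m x : 0 < x -> 0 < F m x by exact: (hF m).1.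
pose U k := [set t | 0 < t < e /\ exists2 N, (k < N)%N &
  k.+1%:R * F i ((chi i - t) * N%:R) < F j ((chi j + t) * N%:R)].
pose V k := [set t | 0 < t < e /\ exists2 N, (k < N)%N &
  k.+1%:R * F j ((chi j + t) * N%:R) < F i ((chi i - t) * N%:R)].
have cont N t : (0 < N)%N -> 0 < t < e ->
    {for t, continuous (fun s => F i ((chi i - s) * N%:R))} /\
    {for t, continuous (fun s => F j ((chi j + s) * N%:R))}.
  move=> N0 /andP[t0 te]; split.
    rewrite (_ : (fun s => _) = fun s => F i ((chi i + (-1) * s) * N%:R)).
      by apply: continuous_ray => //; [exact: feedback_continuous|lra].
    by apply/funext => s; rewrite mulN1r.
  rewrite (_ : (fun s => _) = fun s => F j ((chi j + 1 * s) * N%:R)).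
    apply: continuous_ray => //; first exact: feedback_continuous.
    by rewrite mul1r addr_gt0.
  by apply/funext => s; rewrite mul1r.
have oU k : open (U k) by apply: open_eventually_lt => N t N0 /(cont N t N0).
have oV k : open (V k) by apply: open_eventually_lt => N t N0 /(cont N t N0)[].
have dU k a b : 0 <= a -> a < b -> b <= e -> exists2 t, a < t < b & U k t.
  move=> a0 ab be.
  have [t tab Ht] := ray_dense k echi (chi0 j) c0 C0 q01 (Fpos i) growth Hbig a0 ab be.
  exists t => //; split=> //; case/andP: tab => ta tb.
  by rewrite (le_lt_trans a0 ta) (lt_le_trans tb be).
(* A point in all [U k] and [V k] violates the ratio hypothesis at the shifted proportions.
   Otherwise some [V k] misses an interval, which is the uniform domination of [F i] by [F j] for
   [N > k]. *)
have [[t te UV]|[k [a [b [a0 ab be HV]]]]] := baire_interval e0 oU oV dU.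
  have tchi : 0 < t < chi i by move: te => /andP[-> te]; exact: lt_trans ei.
  have [chiS' chi'i chi'j _] := open_simplex_shift chiS ji tchi.
  case: (Hratio _ chiS').
  set chi' := shift _ _ _ _ in chiS' chi'i chi'j *.
  have pos m N : (0 < N)%N -> 0 < F m (chi' m * N%:R).
    by move=> N0; apply: Fpos; rewrite mulr_gt0 ?ltr0n //; exact: chiS'.1.
  split.
    (* The index starts at 1 because at [N = 0] the ratio involves values at 0, whose sign is
       unknown. *)
    apply: (@limn_einf_eq0 _ _ 1%N) => [n n1|k].
      by rewrite lee_fin divr_ge0 // ltW // pos.
    have [_ [N kN HN]] := (UV k).1; exists N; first exact: ltnW.
    have N0 : (0 < N)%N := leq_ltn_trans (leq0n k) kN.
    rewrite lte_fin ltr_pdivrMr ?pos // -(ltr_pM2l (_ : 0 < k.+1%:R)) //.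
    by rewrite mulrA divff // mul1r chi'i chi'j.
  apply: limn_esup_pinfty => k.
  have [_ [N kN HN]] := (UV k).2; exists N; first exact: ltnW.
  have N0 : (0 < N)%N := leq_ltn_trans (leq0n k) kN.
  rewrite lte_fin ltr_pdivlMr ?pos // chi'i chi'j; apply: le_lt_trans HN.
  by rewrite ler_wpM2r ?ler_nat // -chi'j ltW // pos.
apply: (natceil_ray_sum_le (k := k) echi (chi0 j) C0 q01 (Fpos i) (Fpos j) growth a0 ab be).
move=> t N tab kN; rewrite leNgt; apply/negP => HN; apply: (HV t tab).
by case/andP: tab => ta tb; split; [rewrite (le_lt_trans a0 ta) (lt_le_trans tb be)|exists N].
Qed.

(** Otherwise a small transfer from [i] to [j] stays within the neighbourhood contained in [Dset],
    yet leaves agent [i] without a win with probability at least 1/2 for all large [N]. *)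
Lemma losing_feedback_negligible (R : realType) (A : nat) (F : 'I_A -> R -> R)
  (d : measure_display) (Omega : measurableType d)
  (P : state A -> probability Omega R) (X : nat -> Omega -> state A)
  (i j : 'I_A) (chi : 'I_A -> R) (c : R) :
  feedback F ->
  (forall x0 : state A, (forall j, (1 <= x0 j)%N) -> is_urn F (P x0) X x0) ->
  (forall chi, @open_simplex R A chi ->
     ~ (limn_einf (ratio_seq F chi i j) = 0%E /\
        limn_esup (ratio_seq F chi i j) = +oo%E)) ->
  typeE F i -> j != i -> simplex_interior (Dset P X i) chi -> 0 < c ->
  \forall N \near \oo, F j (start chi N j)%:R < c * F i (start chi N i)%:R.
Proof.
move=> hF hurn Hratio tE ji [chiS [e' e'0 HD]] c0; apply: contrapT => Hnear.
have Hbig M0 : exists2 M, (M0 <= M)%N &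
    c * F i (natceil (chi i * M%:R))%:R <= F j (natceil (chi j * M%:R))%:R.
  apply: contrapT => H; apply: Hnear; exists M0 => // M /= M0M.
  by rewrite !startE ltNge; apply/negP => HM; apply: H; exists M.
pose e := Num.min e' (chi i / 2).
have ci := chiS.1 i.
have ee' : e <= e' by rewrite /e ge_min lexx.
have ei : 0 < e < chi i.
  rewrite /e lt_min e'0 divr_gt0 //= gt_min; apply/orP; right; lra.
have [t /andP[t0 te] Hsum] := ray_dominated hF tE ji chiS ei c0 Hratio Hbig.
have tchi : 0 < t < chi i by rewrite t0; case/andP: ei => _; exact: lt_trans.
have [chiS' chi'i chi'j chi'd] := open_simplex_shift chiS ji tchi.
set chi' := shift _ _ _ _ in chiS' chi'i chi'j chi'd.
have [_ Dcvg] : Dset P X i chi'.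
  by apply: HD => // m; apply: (le_lt_trans (chi'd m)); exact: lt_le_trans ee'.
have [_ /cvgr_gt/(_ 2^-1)] := (fine_cvgP _ _).1 Dcvg.
rewrite invf_lt1 ?ltr1n // => /(_ isT) Dgt.
have [N [[HN Hf] N0]] := filter_ex (filterI (filterI Dgt Hsum) (nbhs_infty_gt 0%N)).
have x00 m : (0 < start chi' N m)%N by apply: start_gt0 => //; exact: chiS'.1.
have urn := hurn _ x00; have mX := urn.1.
have Fpos m n : (0 < n)%N -> 0 < F m n%:R by exact: feedback_gt0.
have mS := measurable_sMon i mX.
have : ((1 - 2^-1)%:E <= P (start chi' N) (~` sMon X i))%E.
  apply: le_trans (le_measure _ _ _ (@frozen_not_sMon _ _ _ X i (start chi' N))).
  - apply: (urn_frozen (B := pred1 i) (a := j) urn) => // m.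
    by rewrite big_pred1_eq !startE chi'i chi'j; exact: Hf.
  - by rewrite inE; apply: bigcap_measurableType => m _; exact: measurable_frozen.
  - by rewrite inE; exact: measurableC.
rewrite probability_setC // -(fineK (fin_num_measure (P (start chi' N)) _ mS)).
by rewrite lee_fin; move: HN => /=; lra.
Qed.

Unset Implicit Arguments.

Theorem mainTheorem9 (R : realType) (A : nat) (F : 'I_A -> R -> R)
  (d : measure_display) (Omega : measurableType d)
  (P : state A -> probability Omega R) (X : nat -> Omega -> state A) :
  (2 <= A)%N ->
  feedback F ->
  (forall x0 : state A, (forall j, (1 <= x0 j)%N) -> is_urn F (P x0) X x0) ->
  (exists k, condM F k) ->
  (forall k, condM F k -> typeP F k \/ typeE F k) ->
  (exists k, typeE F k) ->
  (forall chi, @open_simplex R A chi -> forall i j : 'I_A,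
     ~ (limn_einf (ratio_seq F chi i j) = 0%E /\
        limn_esup (ratio_seq F chi i j) = +oo%E)) ->
  forall (i : 'I_A) (chi : 'I_A -> R),
    typeE F i ->
    simplex_interior (Dset P X i) chi ->
    (fun N => P (start chi N) (tMon X i)) @ \oo --> 1%E.
Proof.
move=> _ hF hurn _ _ _ Hratio i chi tE chiD.
have [chiS _] := chiD.
have [C [q [k0 [C0 q01 k00 growth]]]] := typeE_growth hF tE.
have q1 : 0 < 1 - q by case/andP: q01 => _; rewrite subr_gt0.
have Fpos m n : (0 < n)%N -> 0 < F m n%:R by exact: feedback_gt0.
(* The type E bound recovered for finite sums, with blocks of length 1 in the geometric series. *)
have sum_le k m : (k0 <= k)%N ->
    F i k%:R * \sum_(l < m) (F i (k + l)%N%:R)^-1 <= C / (1 - q).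
  move=> k0k; rewrite mulr_sumr.
  apply: le_trans (_ : \sum_(l < m) C * q ^+ (l %/ 1) <= _).
    apply: ler_sum => l _; rewrite divn1 ler_pdivrMr; first exact: growth.
    by apply: Fpos; rewrite ltn_addr // (leq_trans k00).
  rewrite -mulr_sumr ler_pM2l //.
  by apply: le_trans (sum_expr_div_bounded q01 (ltn0Sn 0) m) _; rewrite mul1r.
have start0 N : (0 < N)%N -> forall m, (0 < start chi N m)%N.
  by move=> N0 m; apply: start_gt0 => //; exact: chiS.1.
have mT N : (0 < N)%N -> measurable (tMon X i).
  by move=> N0; apply: measurable_tMon; exact: (hurn _ (start0 N N0)).1.
apply/fine_cvgP; split.
  (* The event does not depend on [N], so one starting state suffices for its measurability. *)
  near=> N; rewrite fin_num_measure //; apply: (mT 1%N) => //.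
apply/cvgrPdist_le => eps eps0.
(* Fewer than [A.+1] agents each contribute at most [c * (C / (1 - q))], so the total stays below
   [eps]. *)
pose c := eps / (A.+1%:R * (C / (1 - q))).
have c0 : 0 < c by rewrite !(divr_gt0, mulr_gt0).
have small : \forall N \near \oo, forall j, j != i ->
    F j (start chi N j)%:R < c * F i (start chi N i)%:R.
  apply: filter_forall => j; have [->|ji] := eqVneq j i; first exact: nearW.
  have := losing_feedback_negligible hF hurn (fun chi h => Hratio chi h i j) tE ji chiD c0.
  by apply: filterS.
near=> N.
have N0 : (0 < N)%N by near: N; exact: nbhs_infty_gt.
have urn := hurn _ (start0 N N0); have mX := urn.1.
have k0N : (k0 <= start chi N i)%N.
  rewrite -(ler_nat R) startE.
  have /andP[h _] := natceil_itv (mulr_ge0 (ltW (chiS.1 i)) (ler0n R N)).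
  by apply: le_trans h; near: N; apply: near_linear; exact: chiS.1.
have : ((1 - eps)%:E <= P (start chi N) (tMon X i))%E.
  apply: le_trans (le_measure _ _ _ (@frozen_sub_tMon _ _ _ X i (start chi N))).
  - apply: (urn_frozen (B := predC1 i) (a := i) urn) => //=; first by rewrite eqxx.
      exact: start0.
    move=> m; set S := \sum_(l < m) _.
    have S0 : 0 <= S.
      apply: sumr_ge0 => l _; rewrite invr_ge0 ltW // Fpos // ltn_addr //.
      exact: start0.
    have Fi0 := Fpos i _ (start0 N N0 i).
    apply: le_trans (_ : A%:R * c * F i (start chi N i)%:R * S <= _).
      rewrite ler_wpM2r // -mulrA.
      (* The sum is extended to all agents by a nonnegative term for [i], so that its size is simply
         [A]. *)
      apply: le_trans (_ : \sum_(b < A) c * F i (start chi N i)%:R <= _).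
        rewrite [leRHS](bigID (fun b => b != i)) /= -[leLHS]addr0 lerD //.
          apply: ler_sum => b bi; apply: ltW.
          by have /(_ b bi) : forall j, j != i ->
            F j (start chi N j)%:R < c * F i (start chi N i)%:R by near: N.
        by apply: sumr_ge0 => b _; rewrite mulr_ge0 // ltW.
      by rewrite sumr_const card_ord mulr_natl.
    rewrite -mulrA; apply: le_trans (_ : A%:R * c * (C / (1 - q)) <= _).
      by rewrite ler_wpM2l ?sum_le // mulr_ge0 // ltW.
    have D0 : 0 < C / (1 - q) by exact: divr_gt0.
    have -> : A%:R * c * (C / (1 - q)) = eps * (A%:R / A.+1%:R).
      rewrite /c; field.
      by rewrite !gt_eqF.
    by rewrite ler_piMr ?(ltW eps0) // ler_pdivrMr // mul1r ler_nat.
  - by rewrite inE; apply: bigcap_measurableType => m _; exact: measurable_frozen.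
  - by rewrite inE; exact: mT N0.
have mTN := mT N N0.
have := probability_le1 (P (start chi N)) mTN.
rewrite -(fineK (fin_num_measure (P (start chi N)) _ mTN)) !lee_fin /=.
by move=> h1 h2; rewrite ger0_norm; lra.
Unshelve. all: by end_near. Qed.
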